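(* Let $N\ge 1$ be an integer and let $\mathrm{BS}(N,N)=\langle a,b\mid a^N b=b a^N\rangle$, with the associated generating functions $G(z;q)$, $L(z;q)$, $K(z;q)$ and the operator $\Phi_{N,N}$ as defined in the context. Then $K(z;q)=L(z;q)$, and, writing $G=G(z;q)$, $L=L(z;q)$ and $L_0=L_0(z;q)=\Phi_{N,N}\circ L$, $$L = 1+z(q+q^{-1})L+2z^2 L\cdot L_0 - z^2 L_0^2,\qquad G = 1+z(q+q^{-1})G+2z^2\,G\cdot L_0 .$$ Further, these equations reduce to a system of algebraic equations in $G$, $L$ and $L_0$: with $\omega=e^{2\pi i/N}$, $$N L_0(z;q)=\sum_{j=0}^{N-1}L(z;\omega^j q)=\sum_{j=0}^{N-1}\frac{1-z^2L_0(z;q)^2}{1-z\left(\omega^j q+\omega^{-j}q^{-1}\right)-2z^2L_0(z;q)} .$$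
   Context: Words are finite words in the letters $a,a^{-1},b,b^{-1}$, not required to be freely reduced. Let $\mathcal H$ be the set of words representing an element of the subgroup $\langle a\rangle$ of $\mathrm{BS}(N,N)$. Let $\mathcal L\subseteq\mathcal H$ be the set of words in $\mathcal H$ that cannot be written as a concatenation $uv$ where $u$ represents an element of the form $b^{-1}a^j$ for some $j\in\mathbb Z$. Let $\mathcal K\subseteq\mathcal H$ be the set of words in $\mathcal H$ that cannot be written as $uv$ where $u$ represents an element of the form $ba^j$ for some $j\in\mathbb Z$. Define $G(z;q)=\sum_{n,k}g_{n,k}z^nq^k$, where $g_{n,k}$ is the number of words of length $n$ in $\mathcal H$ representing $a^k$ ($k\in\mathbb Z$); $L(z;q)$ and $K(z;q)$ are defined in the same way, counting only words in $\mathcal L$ and $\mathcal K$ respectively. These are formal power series in $z$ whose coefficients are Laurent polynomials in $q$. The operator $\Phi_{d,e}$ acts by $\Phi_{d,e}\circ\sum_n z^n\sum_k c_{n,k}q^k=\sum_n z^n\sum_j c_{n,dj}\,q^{ej}$. *)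

(* Defs.v *)
From HB Require Import structures.
From mathcomp Require Import all_boot all_order all_algebra.
From mathcomp Require Import finmap complex.
From mathcomp Require Import boolp classical_sets cardinality fsbigop.
From mathcomp Require Import reals trigo.

Set Implicit Arguments.
Unset Strict Implicit.
Unset Printing Implicit Defensive.

Import Order.TTheory GRing.Theory Num.Theory.
Local Open Scope classical_set_scope.
Local Open Scope ring_scope.

(** Laurent polynomials in [q]: [lcoef f k] is the coefficient of [q^k]. *)
Record laurent (R : nzRingType) := Laurent {
  lcoef :> int -> R;
  lcoef_finite : finite_set [set k | lcoef k != 0] }.

Section LaurentRing.
Variable R : comNzRingType.
Implicit Types (f g h : laurent R) (c : R) (k : int).

HB.instance Definition _ := gen_eqMixin (laurent R).
HB.instance Definition _ := gen_choiceMixin (laurent R).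

Lemma laurentP f g : (forall k, f k = g k) -> f = g.
Proof.
case: f g => [f Pf] [g Pg] /= fg.
have fgE : f = g by apply/funext.
by rewrite {}fgE in Pf *; rewrite (Prop_irrelevance Pf Pg).
Qed.

Definition lsupp f : {fset int} := fset_set [set k | f k != 0].

Lemma lsupp0 f k : k \notin lsupp f -> f k = 0.
Proof.
rewrite /lsupp in_fset_set; last exact: lcoef_finite.
by rewrite notin_setE /= => /negP; rewrite negbK => /eqP.
Qed.

Lemma finite_in_fset (A : {fset int}) (P : int -> R) :
  (forall k, k \notin A -> P k = 0) -> finite_set [set k | P k != 0].
Proof.
move=> P0; apply: (sub_finite_set _ (finite_fset A)) => k /=.
by apply: contraR => /P0 ->.
Qed.

Lemma lmono_finite c k :
  finite_set [set i | (if i == k then c else 0) != 0].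
Proof.
apply: (@finite_in_fset [fset k]%fset) => i.
by rewrite inE => /negPf ->.
Qed.
(** [c q^k] *)
Definition lmono c k := Laurent (lmono_finite c k).

Lemma ladd_finite f g : finite_set [set k | f k + g k != 0].
Proof.
apply: (@finite_in_fset (lsupp f `|` lsupp g)%fset) => i.
by rewrite inE negb_or => /andP[/lsupp0 -> /lsupp0 ->]; rewrite addr0.
Qed.
Definition ladd f g := Laurent (ladd_finite f g).

Lemma lopp_finite f : finite_set [set k | - f k != 0].
Proof.
by apply: (@finite_in_fset (lsupp f)) => i /lsupp0 ->; rewrite oppr0.
Qed.
Definition lopp f := Laurent (lopp_finite f).

Lemma lconvE (A : {fset int}) f g k : (forall i, i \notin A -> f i = 0) ->
  \sum_(i \in [set: int]) f i * g (k - i) = \sum_(i <- A) f i * g (k - i).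
Proof. by move=> f0; apply: fsbigTE => i /f0 ->; rewrite mul0r. Qed.

Lemma lmul_finite f g :
  finite_set [set k | \sum_(i \in [set: int]) f i * g (k - i) != 0].
Proof.
apply: (@finite_in_fset [fset (i + j)%R | i in lsupp f, j in lsupp g]%fset
  (fun k => \sum_(i \in [set: int]) f i * g (k - i))) => k kN.
 rewrite (@lconvE (lsupp f)); last exact: lsupp0.
rewrite big_seq big1 // => i iF.
rewrite [g _]lsupp0 ?mulr0 //; apply: contra kN => kG.
by apply/imfset2P; exists i => //; exists (k - i) => //; rewrite addrC subrK.
Qed.
Definition lmul f g := Laurent (lmul_finite f g).

Fact laddA : associative ladd.
Proof. by move=> f g h; apply: laurentP => k /=; rewrite addrA. Qed.
Fact laddC : commutative ladd.
Proof. by move=> f g; apply: laurentP => k /=; rewrite addrC. Qed.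
Fact ladd0 : left_id (lmono 0 0) ladd.
Proof. by move=> f; apply: laurentP => k /=; case: ifP; rewrite add0r. Qed.
Fact laddN : left_inverse (lmono 0 0) lopp ladd.
Proof. by move=> f; apply: laurentP => k /=; case: ifP; rewrite addNr. Qed.

HB.instance Definition _ :=
  GRing.isZmodule.Build (laurent R) laddA laddC ladd0 laddN.

Fact lmulC : commutative lmul.
Proof.
move=> f g; apply: laurentP => k /=.
rewrite (@reindex_fsbigT _ _ _ _ _ (fun i => k - i)); last first.
  by exists (fun i => k - i) => i; rewrite subKr.
by apply: eq_fsbigr => i _; rewrite subKr mulrC.
Qed.

Fact lmulA : associative lmul.
Proof.
move=> f g h; apply: laurentP => k /=.
pose F := lsupp f; pose G := lsupp g.
pose S := [fset (i + j)%R | i in F, j in G]%fset.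
rewrite (@lconvE F _ (lmul g h)); last exact: lsupp0.
rewrite (@lconvE S (lmul f g)); last first.
  move=> m mN /=; rewrite (@lconvE F); last exact: lsupp0.
  rewrite big_seq big1 // => i iF.
  rewrite [g _]lsupp0 ?mulr0 //; apply: contra mN => mG.
  by apply/imfset2P; exists i => //; exists (m - i) => //; rewrite addrC subrK.
under [RHS]eq_bigr => m _ do
  rewrite /= (@lconvE F f g m (@lsupp0 f)) big_distrl /=.
rewrite exchange_big /= big_seq [RHS]big_seq; apply: eq_bigr => i iF.
under [RHS]eq_bigr => m _ do rewrite -mulrA.
rewrite -big_distrr /=; congr (_ * _).
rewrite -(@fsbigTE _ _ _ _ S (fun m => g (m - i) * h (k - m))); last first.
  move=> m mN; rewrite [g _]lsupp0 ?mul0r //; apply: contra mN => mG.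
  by apply/imfset2P; exists i => //; exists (m - i) => //; rewrite addrC subrK.
rewrite [RHS](@reindex_fsbigT _ _ _ _ _ (fun j => j + i)); last first.
  by exists (fun j => j - i) => j; rewrite ?addrK ?subrK.
by apply: eq_fsbigr => j _; rewrite addrK opprD addrA addrAC.
Qed.

Fact lmul1 : left_id (lmono 1 0) lmul.
Proof.
move=> f; apply: laurentP => k /=.
rewrite (@fsbigTE _ _ _ _ [fset 0%R]%fset) /=; last first.
  by move=> i; rewrite inE => /negPf ->; rewrite mul0r.
by rewrite big_seq_fset1 eqxx mul1r subr0.
Qed.

Fact lmulDl : left_distributive lmul ladd.
Proof.
move=> f g h; apply: laurentP => k /=.
pose A := (lsupp f `|` lsupp g)%fset.
have Af i : i \notin A -> f i = 0.
  by rewrite inE negb_or => /andP[/lsupp0].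
have Ag i : i \notin A -> g i = 0.
  by rewrite inE negb_or => /andP[_ /lsupp0].
rewrite (@lconvE A (ladd f g)) ?(@lconvE A f) ?(@lconvE A g) //; last first.
  by move=> i iA /=; rewrite Af ?Ag ?addr0.
by rewrite -big_split; apply: eq_bigr => i _ /=; rewrite mulrDl.
Qed.

Fact lone_neq0 : lmono 1 0 != 0 :> laurent R.
Proof.
apply/eqP => /(congr1 (fun f : laurent R => f 0)) /= /eqP.
by rewrite oner_eq0.
Qed.

HB.instance Definition _ :=
  GRing.Zmodule_isComNzRing.Build (laurent R) lmulA lmulC lmul1 lmulDl lone_neq0.

Lemma lcoefM f g k : (f * g) k = \sum_(i \in [set: int]) f i * g (k - i).
Proof. by []. Qed.

(** [sum_k c_k q^k |-> sum_j c_(d j) q^(e j)]; the right-hand side is a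
    finite-support sum in [laurent R] whenever [d != 0]. *)
Definition lphi (d e : int) f : laurent R :=
  \sum_(j \in [set: int]) lmono (f (d * j)) (e * j).

End LaurentRing.

Section LaurentSubst.
Variable F : fieldType.

Lemma lsubst_finite (u : F) (f : laurent F) :
  finite_set [set k | f k * u ^ k != 0].
Proof.
by apply: (@finite_in_fset F (lsupp f)) => i /lsupp0 ->; rewrite mul0r.
Qed.
Definition lsubst u f := Laurent (lsubst_finite u f).

End LaurentSubst.

(** Formal power series in [z]. *)
Record fps (R : Type) := Fps { fcoef :> nat -> R }.

Section FpsRing.
Variable R : comNzRingType.
Implicit Types (f g h : fps R).

HB.instance Definition _ := gen_eqMixin (fps R).
HB.instance Definition _ := gen_choiceMixin (fps R).

Lemma fpsP f g : (forall n, f n = g n) -> f = g.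
Proof. by case: f g => [f] [g] /= /funext ->. Qed.

Definition fpsC (c : R) : fps R := Fps (fun n => if n == 0%N then c else 0).
Definition fpsX : fps R := Fps (fun n => (n == 1%N)%:R).
Definition fps_of_poly (p : {poly R}) : fps R := Fps (fun n => p`_n).

Definition fadd f g := Fps (fun n => f n + g n).
Definition fopp f := Fps (fun n => - f n).
Definition fmul f g := Fps (fun n => \sum_(i < n.+1) f i * g (n - i)%N).

Fact faddA : associative fadd.
Proof. by move=> f g h; apply: fpsP => k /=; rewrite addrA. Qed.
Fact faddC : commutative fadd.
Proof. by move=> f g; apply: fpsP => k /=; rewrite addrC. Qed.
Fact fadd0 : left_id (fpsC 0) fadd.
Proof. by move=> f; apply: fpsP => k /=; case: ifP; rewrite add0r. Qed.
Fact faddN : left_inverse (fpsC 0) fopp fadd.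
Proof. by move=> f; apply: fpsP => k /=; case: ifP; rewrite addNr. Qed.

HB.instance Definition _ :=
  GRing.isZmodule.Build (fps R) faddA faddC fadd0 faddN.

Definition ftrunc n f := \poly_(i < n.+1) f i.

Lemma ftruncE n k f : (k <= n)%N -> (ftrunc n f)`_k = f k.
Proof. by move=> kn; rewrite coef_poly ltnS kn. Qed.

Lemma fmul_coef (n k : nat) f g (p r : {poly R}) : (k <= n)%N ->
    (forall i, (i <= n)%N -> p`_i = f i) ->
    (forall i, (i <= n)%N -> r`_i = g i) ->
  fmul f g k = (p * r)`_k.
Proof.
move=> kn pf rg; rewrite coefM /=; apply: eq_bigr => i _.
have ik : (i <= k)%N by rewrite -ltnS.
by rewrite pf ?rg ?(leq_trans _ kn) // leq_subr.
Qed.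

Fact fmulA : associative fmul.
Proof.
move=> f g h; apply: fpsP => n.
rewrite (@fmul_coef n n _ _ (ftrunc n f) (ftrunc n g * ftrunc n h)) //.
- rewrite (@fmul_coef n n _ _ (ftrunc n f * ftrunc n g) (ftrunc n h)) //.
  + by rewrite mulrA.
  + by move=> i ni; rewrite -(@fmul_coef n i f g) // => j; exact: ftruncE.
  + by move=> i; exact: ftruncE.
- by move=> i; exact: ftruncE.
- by move=> i ni; rewrite -(@fmul_coef n i g h) // => j; exact: ftruncE.
Qed.

Fact fmulC : commutative fmul.
Proof.
move=> f g; apply: fpsP => n.
rewrite (@fmul_coef n n _ _ (ftrunc n f) (ftrunc n g)) //;
  try by move=> i; exact: ftruncE.
rewrite (@fmul_coef n n _ _ (ftrunc n g) (ftrunc n f)) 1?mulrC //;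
  by move=> i; exact: ftruncE.
Qed.

Fact fmul1 : left_id (fpsC 1) fmul.
Proof.
move=> f; apply: fpsP => n /=; rewrite big_ord_recl /= mul1r subn0.
by rewrite big1 ?addr0 // => i _; rewrite mul0r.
Qed.

Fact fmulDl : left_distributive fmul fadd.
Proof.
move=> f g h; apply: fpsP => n /=; rewrite -big_split /=.
by apply: eq_bigr => i _; rewrite mulrDl.
Qed.

Fact fone_neq0 : fpsC 1 != 0 :> fps R.
Proof.
apply/eqP => /(congr1 (fun f : fps R => f 0%N)) /= /eqP.
by rewrite oner_eq0.
Qed.

HB.instance Definition _ :=
  GRing.Zmodule_isComNzRing.Build (fps R) fmulA fmulC fmul1 fmulDl fone_neq0.

Lemma fcoefM f g n : (f * g) n = \sum_(i < n.+1) f i * g (n - i)%N.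
Proof. by []. Qed.

Definition funit : pred (fps R) := fun f => `[< exists g, g * f = 1 >].
Definition finv f : fps R :=
  if pselect (exists g, g * f = 1) is left ex then projT1 (cid ex) else f.

Fact fmulVr : {in funit, left_inverse 1 finv *%R}.
Proof.
move=> f /asboolP fU; rewrite /finv; case: pselect => // ex.
by case: cid.
Qed.
Fact funitP f g : g * f = 1 -> funit f.
Proof. by move=> gf; apply/asboolP; exists g. Qed.
Fact finv_out : {in [predC funit], finv =1 id}.
Proof.
by move=> f /asboolP fU; rewrite /finv; case: pselect.
Qed.

HB.instance Definition _ :=
  GRing.ComNzRing_hasMulInverse.Build (fps R) fmulVr funitP finv_out.

Lemma fcoefX_lt f n m : f 0%N = 0 -> (n < m)%N -> (f ^+ m) n = 0.
Proof.
move=> f0; elim: m n => // m IH n nm.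
rewrite exprS fcoefM big_ord_recl f0 mul0r add0r big1 // => i _.
rewrite IH ?mulr0 //= /bump /= add1n.
by have := ltn_ord i; case: n nm {i} (val i) => // n nm i _;
   rewrite subSS; apply: leq_ltn_trans (leq_subr _ _) _.
Qed.

(** A series with constant coefficient 1 is invertible, so that quotients by it
    in the [unitRingType] [fps R] are genuine. *)
Lemma fps_unit1 f : f 0%N = 1 -> f \is a GRing.unit.
Proof.
move=> f0; pose g := 1 - f.
have g0 : g 0%N = 0 by rewrite /g -[LHS]/(1 - f 0%N) f0 subrr.
have fE : f = 1 - g by rewrite subKr.
have coefS (n k : nat) (F : nat -> fps R) :
    (\sum_(i < n) F i) k = \sum_(i < n) F i k.
  elim: n => [|n IH]; first by rewrite !big_ord0; case: k.
  by rewrite !big_ord_recr -IH.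
pose s n := \sum_(m < n.+1) g ^+ m.
have sE n k : (k <= n)%N -> s n k = s k k.
  move=> /subnKC <-; elim: (n - k)%N => [|d IH]; first by rewrite addn0.
  rewrite addnS -{}IH /s !coefS big_ord_recr /=.
  by rewrite [X in _ + X]fcoefX_lt ?addr0 // ltnS leq_addr.
pose t : fps R := Fps (fun n => s n n).
suff : t * f = 1 by move=> tf; apply/asboolP; exists t.
apply: fpsP => n.
transitivity ((s n * f) n).
  rewrite !fcoefM; apply: eq_bigr => i _; congr (_ * _).
  by rewrite sE // -ltnS.
have -> : s n * f = 1 - g ^+ n.+1.
  rewrite [in LHS]fE mulrC /s -[RHS]opprB subrX1.
  by rewrite -(mulNr (g - 1)) (opprB g 1).
by rewrite -[LHS]/((1 : fps R) n - (g ^+ n.+1) n) fcoefX_lt // subr0.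
Qed.

End FpsRing.

Definition fps_map (R S : Type) (phi : R -> S) (f : fps R) : fps S :=
  Fps (fun n => phi (f n)).

Definition Phi (R : comNzRingType) (d e : int) (f : fps (laurent R)) :
  fps (laurent R) := fps_map (lphi d e) f.

(** [qsubst u F] is [F(z; u q)]. *)
Definition qsubst (F : fieldType) (u : F) (f : fps (laurent F)) :
  fps (laurent F) := fps_map (lsubst u) f.

Inductive letter := La | LaV | Lb | LbV.

Definition letter_code (x : letter) : bool * bool :=
  match x with
  | La => (false, false) | LaV => (false, true)
  | Lb => (true, false) | LbV => (true, true)
  end.
Definition letter_decode (c : bool * bool) : letter :=
  match c with
  | (false, false) => La | (false, true) => LaV
  | (true, false) => Lb | (true, true) => LbV
  end.
Lemma letter_codeK : cancel letter_code letter_decode.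
Proof. by case. Qed.
HB.instance Definition _ := Finite.copy letter (can_type letter_codeK).

Definition linv (x : letter) : letter :=
  match x with La => LaV | LaV => La | Lb => LbV | LbV => Lb end.

Notation word := (seq letter).

(** [bs_eq N u v]: the words [u] and [v] represent the same element of
    [<a, b | a^N b = b a^N>]; it is the congruence generated by the relator and
    the free cancellations. *)
Inductive bs_eq (N : nat) : word -> word -> Prop :=
| bs_refl w : bs_eq N w w
| bs_sym u v : bs_eq N u v -> bs_eq N v u
| bs_trans u v w : bs_eq N u v -> bs_eq N v w -> bs_eq N u w
| bs_cat u u' v v' : bs_eq N u u' -> bs_eq N v v' -> bs_eq N (u ++ v) (u' ++ v')
| bs_cancel x : bs_eq N [:: x; linv x] [::]
| bs_rel : bs_eq N (nseq N La ++ [:: Lb]) (Lb :: nseq N La).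

Definition apow (k : int) : word :=
  match k with Posz n => nseq n La | Negz n => nseq n.+1 LaV end.

Definition inH (N : nat) (w : word) : Prop := exists k, bs_eq N w (apow k).

Definition inL (N : nat) (w : word) : Prop :=
  inH N w /\
  ~ (exists u v j, w = u ++ v /\ bs_eq N u (LbV :: apow j)).

Definition inK (N : nat) (w : word) : Prop :=
  inH N w /\
  ~ (exists u v j, w = u ++ v /\ bs_eq N u (Lb :: apow j)).

Definition nwords (N : nat) (A : word -> Prop) (n : nat) (k : int) : nat :=
  #|[set w : n.-tuple letter | `[< A w /\ bs_eq N w (apow k) >]]%SET|.

Definition aexp (w : word) : int :=
  \sum_(x <- w) match x with La => 1 | LaV => -1 | _ => 0 end.

Lemma aexp_cat u v : aexp (u ++ v) = aexp u + aexp v.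
Proof. by rewrite /aexp big_cat. Qed.

Lemma aexp_bs_eq N u v : bs_eq N u v -> aexp u = aexp v.
Proof.
elim=> {u v} [//|u v _ -> //|u v w _ -> //|u u' v v' _ IHu _ IHv|x|].
- by rewrite !aexp_cat IHu IHv.
- by rewrite /aexp !big_cons !big_nil; case: x.
- by rewrite -[in RHS]cat1s !aexp_cat addrC.
Qed.

Lemma aexp_apow k : aexp (apow k) = k.
Proof.
have nseqE x n : aexp (nseq n x) = aexp [:: x] *+ n.
  elim: n => [|n IH]; first by rewrite mulr0n /aexp big_nil.
  by rewrite -[nseq n.+1 x]/([:: x] ++ nseq n x) aexp_cat IH mulrS.
case: k => n; rewrite /apow nseqE /aexp big_cons big_nil addr0.
  exact: natz.
by rewrite NegzE mulNrn natz.
Qed.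

Lemma aexp_le w : `|aexp w| <= (size w)%:Z.
Proof.
elim: w => [|x w IH]; first by rewrite /aexp big_nil.
rewrite /aexp big_cons; apply: le_trans (ler_normD _ _) _.
rewrite [size _]/= -add1n PoszD; apply: lerD => //.
by case: x.
Qed.

Lemma nwords_finite (R : nzRingType) N A n :
  finite_set [set k | (nwords N A n k)%:R != 0 :> R].
Proof.
apply: (@sub_finite_set _ _
  [set` [fset (i%:Z - n%:Z)%R | i in iota 0 (n + n).+1]%fset]).
  move=> k /= nz; have : nwords N A n k != 0%N.
    by apply: contra nz => /eqP ->.
  rewrite -lt0n => /card_gt0P[w]; rewrite inE => /asboolP[_ /aexp_bs_eq].
  rewrite aexp_apow => wk; have := aexp_le w; rewrite wk size_tuple ler_norml.
  move=> /andP[kn nk]; have : 0 <= k + n%:Z by rewrite -lerBlDr sub0r.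
  case E : (k + n%:Z) => [m|//] _; apply/imfsetP; exists m; last first.
    by rewrite /= -E addrK.
  rewrite (mem_iota 0 (n + n).+1) add0n leq0n ltnS -lez_nat -E.
  by rewrite [X in _ <= X]PoszD lerD2r.
exact: finite_fset.
Qed.

Definition genfun (R : comNzRingType) (N : nat) (A : word -> Prop) :
    fps (laurent R) :=
  Fps (fun n => Laurent (@nwords_finite R N A n)).

(** [e^(2 pi i / N)] *)
Definition omega (R : realType) (N : nat) : R[i] :=
  (cos (2 * pi / N%:R) +i* sin (2 * pi / N%:R))%C.

(* Main.v *)
Require Import Defs.
From HB Require Import structures.
From mathcomp Require Import all_boot all_order all_algebra.
From mathcomp Require Import finmap complex boolp fsbigop.
From mathcomp Require Import reals trigo.
From mathcomp Require Import ring lra zify.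
From Stdlib Require Import Setoid Morphisms.

(** A word acts on Britton normal forms, i.e. it traces a path in the
    Bass-Serre tree of BS(N,N), and it lies in <a> iff the path returns to the
    vertex <a>. A nonempty closed path either ends with a letter a^{+-1}, or ends
    with a unique last excursion b^e v b^{-e}, where v represents an element of
    <a^N> and its path avoids the neighbour b^{-e}<a>. Hence v is counted by
    L_0 or K_0, and exchanging b with b^{-1} shows L = K. A word of L may be
    extended by any excursion except those through b^{-1}<a>, that is with
    e = -1 after a prefix in <a^N>, whence the correction term -z^2 L_0^2.
    Summing over q -> omega^j q keeps exactly the powers of q^N, and these
    substitutions leave L_0 invariant, so solving the first equation for L gives
    the last identity. Clearing denominators there yields a polynomial equation
    for L_0, nonzero because its value at z = 0, L_0 = 0 is -N. *)

Set Implicit Arguments.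
Unset Strict Implicit.
Unset Printing Implicit Defensive.

Import Order.TTheory GRing.Theory Num.Theory.
Local Open Scope ring_scope.

(** * Word calculus in BS(N,N) *)

#[local] Instance bs_eq_equiv N : Equivalence (bs_eq N).
Proof. by split; [exact: bs_refl | exact: bs_sym | exact: bs_trans]. Qed.

#[local] Instance bs_eq_cat N :
  Proper (bs_eq N ==> bs_eq N ==> bs_eq N) (@cat letter).
Proof. by move=> u u' Hu v v' Hv; exact: bs_cat. Qed.

#[local] Hint Resolve bs_refl : core.

Section Group.
Variable N : nat.
Local Notation "u ~ v" := (bs_eq N u v) (at level 70).

Definition winv (u : word) : word := rev (map linv u).

Lemma linvK : involutive linv.
Proof. by case. Qed.

Lemma bs_cancelV x : [:: linv x; x] ~ [::].
Proof. by rewrite -{2}(linvK x); exact: bs_cancel. Qed.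

Lemma winvl u : winv u ++ u ~ [::].
Proof.
elim: u => [|x u IH]; first by [].
rewrite /winv /= rev_cons cat_rcons -[linv x :: _]/([:: linv x; x] ++ u).
by rewrite bs_cancelV.
Qed.

Lemma bs_cancell u v v' : u ++ v ~ u ++ v' -> v ~ v'.
Proof.
move=> uv; rewrite -[v]/([::] ++ v) -[v']/([::] ++ v') -(winvl u) -!catA.
by rewrite uv.
Qed.

Lemma apow_nseq k n :
  (apow k ++ nseq n La ~ apow (k + n%:Z)) *
  (apow k ++ nseq n LaV ~ apow (k - n%:Z)).
Proof.
have nS m (x : letter) : nseq m.+1 x = nseq m x ++ [:: x].
  by rewrite -addn1 nseqD.
have S1 l : (apow l ++ [:: La] ~ apow (l + 1)).
  case: l => [m|[|m]].
  - by rewrite -PoszD /apow addn1 nS.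
  - exact: (bs_cancel N LaV).
  - have -> : Negz m.+1 + 1 = Negz m.
      by rewrite !NegzE -[in m.+2]addn1 PoszD opprD addrNK.
    rewrite {1}/apow nS -catA -[[:: LaV] ++ _]/[:: LaV; La].
    by rewrite (bs_cancel N LaV) cats0.
have S2 l : (apow l ++ [:: LaV] ~ apow (l - 1)).
  case: l => [[|m]|m].
  - by [].
  - rewrite -addn1 PoszD addrK -PoszD addn1 /apow nS -catA.
    rewrite -[[:: La] ++ _]/[:: La; LaV].
    by rewrite (bs_cancel N La) cats0.
  - have -> : Negz m - 1 = Negz m.+1 by rewrite !NegzE -opprD -PoszD addn1.
    by rewrite /apow -nS.
elim: n => [|n [IH1 IH2]]; first by rewrite !cats0 addr0.
have kS : (k + n%:Z + 1 = k + n.+1%:Z) * (k - n%:Z - 1 = k - n.+1%:Z).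
  by rewrite -addn1 PoszD opprD !addrA.
split; rewrite nS catA; first by rewrite IH1 S1 kS.
by rewrite IH2 S2 kS.
Qed.

Lemma apowD k l : apow k ++ apow l ~ apow (k + l).
Proof. by case: l => n; rewrite ?NegzE /apow apow_nseq; reflexivity. Qed.

Definition bl (e : bool) : letter := if e then LbV else Lb.

Lemma blC e : [:: bl e; bl (~~ e)] ~ [::].
Proof. by case: e; [exact: (bs_cancel N LbV) | exact: (bs_cancel N Lb)]. Qed.

Lemma blCK e v : [:: bl e] ++ [:: bl (~~ e)] ++ v ~ v.
Proof. by rewrite catA -[[:: bl _] ++ [:: _]]/[:: bl e; bl (~~ e)] blC. Qed.

(** The relator makes a^N commute with b; passing to inverses ([commV]) extends this to b^-1 and to
    negative powers. Hence <a^N> is central, which drives all cancellations below. *)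
Lemma apow_bl e k : (N %| k)%Z -> apow k ++ [:: bl e] ~ [:: bl e] ++ apow k.
Proof.
have commV u u' v : u ++ u' ~ [::] -> u' ++ u ~ [::] ->
    u ++ v ~ v ++ u -> u' ++ v ~ v ++ u'.
  move=> uu' u'u uv; apply: (@bs_cancell u).
  by rewrite !catA uu' uv -catA uu' cats0.
have c1 : apow N ++ [:: bl e] ~ [:: bl e] ++ apow N.
  case: e; last exact: bs_rel.
  symmetry; apply: (commV [:: Lb]).
  - exact: (bs_cancel N Lb).
  - exact: (bs_cancel N LbV).
  symmetry; exact: bs_rel.
have cn (n : nat) : apow (n * N)%N ++ [:: bl e] ~ [:: bl e] ++ apow (n * N)%N.
  elim: n => [|n IH]; first by [].
  rewrite mulSn PoszD -apowD -catA IH catA c1 -catA; reflexivity.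
move=> /dvdzP[[n|n] ->]; first exact: cn.
rewrite NegzE mulNr -PoszM.
by apply: (commV (apow (n.+1 * N)%N)) => //; rewrite apowD ?subrr ?addNr.
Qed.

End Group.

(** * Britton normal forms *)

(* [(t, k)] encodes the Britton normal form [.. a^r2 b^e2 a^r1 b^e1 a^k] with
   [t = [:: (e1, r1); (e2, r2); ..]]; the sign [true] stands for [b^-1]. *)
Notation state := (seq (bool * int) * int)%type.

(** Right multiplication by b^e. As <a^N> is central, a^k b^e equals a^(k mod N) b^e a^(k - k mod
    N); the popping branch is Britton's pinch b^-e a^k b^e = a^k for N dividing k. *)
Definition bstep (N : nat) (e : bool) (s : state) : state :=
  let: (t, k) := s in
  let push := ((e, (k %% N)%Z) :: t, k - (k %% N)%Z) in
  if t is (e', r) :: t' then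
    if (e' == ~~ e) && (N %| k)%Z then (t', r + k) else push
  else push.

Definition step (N : nat) (s : state) (x : letter) : state :=
  match x with
  | La => (s.1, s.2 + 1) | LaV => (s.1, s.2 - 1)
  | Lb => bstep N false s | LbV => bstep N true s
  end.

Definition act N := foldl (step N).
Definition run N := act N ([::], 0).

(** Britton's condition: exponents are coset representatives of <a^N> in <a>, and letters b^e' b^e
    of opposite signs are never adjacent. Such stacks name the vertices g<a> of the Bass-Serre
    tree. *)
Fixpoint reduced (N : nat) (t : seq (bool * int)) : bool :=
  if t is (e, r) :: t' then
    [&& 0 <= r < N%:Z, (r == 0) ==> (if t' is (e', _) :: _ then e' == e else true)
      & reduced N t']
  else true.

Fixpoint wstack (t : seq (bool * int)) : word :=
  if t is (e, r) :: t' then wstack t' ++ apow r ++ [:: bl e] else [::].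
Definition wstate (s : state) : word := wstack s.1 ++ apow s.2.

Section Run.
Variable N : nat.
Hypothesis N_gt0 : (0 < N)%N.
Local Notation "u ~ v" := (bs_eq N u v) (at level 70).
Local Notation step := (step N).
Local Notation act := (act N).
Local Notation run := (run N).

Let N_neq0 : N%:Z != 0. Proof. by rewrite eqz_nat -lt0n. Qed.

Lemma modz_bound k : 0 <= (k %% N)%Z < N%:Z.
Proof. by rewrite modz_ge0 //= (le_lt_trans _ (ltz_mod k N_neq0)). Qed.

Lemma dvdz_subm k : (N %| k - (k %% N)%Z)%Z.
Proof. by apply/dvdzP; exists (k %/ N)%Z; rewrite {1}(divz_eq k N) addrK. Qed.

Lemma step_bl s e : step s (bl e) = bstep N e s.
Proof. by case: e. Qed.

(** After a push the inverse letter pops. After a pop it must push: a second pop would need r = 0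
    between letters of opposite signs, which [reduced] forbids. *)
Lemma bstepK e s : reduced N s.1 -> bstep N (~~ e) (bstep N e s) = s.
Proof.
case: s => -[|[e' r] t] k /=.
  by rewrite negbK eqxx dvdz_subm /= addrC subrK.
case/and3P=> r_bd red_r _; case: ifP => [/andP[/eqP e'E Nk]|_]; last first.
  by rewrite /= negbK eqxx dvdz_subm /= addrC subrK.
have rE : ((r + k) %% N)%Z = r.
  by rewrite -modzDmr (dvdz_mod0P Nk) addr0 modz_small.
rewrite /bstep rE addrAC subrr add0r -e'E.
case: t red_r => [//|[e'' r''] t] red_r.
case: ifP => // /andP[/eqP e''E] /dvdz_mod0P; rewrite rE => r0.
by move: red_r; rewrite r0 eqxx e''E e'E /=; case: (e).
Qed.

Lemma step_reduced s x : reduced N s.1 -> reduced N (step s x).1.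
Proof.
suff redb e : reduced N s.1 -> reduced N (bstep N e s).1.
  by case: x => //; exact: redb.
case: s => -[|[e' r] t] k /=; first by rewrite modz_bound /= implybT.
move=> red; case: ifP => [_ /=|eN /=]; first by case/and3P: red.
rewrite modz_bound red andbT /=; apply/implyP => /eqP k0.
have Nk : (N %| k)%Z by apply/dvdz_mod0P.
move/negP: eN; rewrite Nk andbT.
by case: (e) (e') => [] [].
Qed.

Lemma act_cat s u v : act s (u ++ v) = act (act s u) v.
Proof. exact: foldl_cat. Qed.

Lemma act_reduced s u : reduced N s.1 -> reduced N (act s u).1.
Proof. by elim: u s => //= x u IH s /(step_reduced x) /IH. Qed.

Lemma act_nseq s n : act s (nseq n La) = (s.1, s.2 + n%:Z) /\
  act s (nseq n LaV) = (s.1, s.2 - n%:Z).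
Proof.
elim: n s => [|n IH] [t k] /=; first by rewrite addr0.
by split; [rewrite (IH _).1 | rewrite (IH _).2];
  rewrite /= -add1n PoszD ?opprD addrA.
Qed.

Lemma act_apow s k : act s (apow k) = (s.1, s.2 + k).
Proof. by case: k => n; rewrite /apow ?NegzE; apply act_nseq. Qed.

(** This is the relator at the level of states: adding N to the exponent commutes with a b-step. *)
Lemma bstep_addN e t k : bstep N e (t, k + N%:Z) =
  ((bstep N e (t, k)).1, (bstep N e (t, k)).2 + N%:Z).
Proof.
have NE : (N %| k + N%:Z)%Z = (N %| k)%Z.
  by rewrite !(sameP dvdz_mod0P eqP) modzDr.
rewrite /bstep modzDr NE; case: t => [|[e' r] t] /=; first by rewrite addrAC.
by case: ifP => _ /=; rewrite ?addrA // addrAC.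
Qed.

#[global] Arguments bstep : simpl never.

(** Each generating relation of the congruence acts trivially on reduced states, so [act] is an
    action of the group. *)
Lemma bs_eq_act u v s : u ~ v -> reduced N s.1 -> act s u = act s v.
Proof.
move=> uv; elim: uv s => {u v}.
- by [].
- by move=> u v _ IH s red; rewrite IH.
- by move=> u v w _ IH1 _ IH2 s red; rewrite IH1 // IH2.
- move=> u u' v v' _ IHu _ IHv s red.
  by rewrite !act_cat IHu // IHv //; apply: act_reduced.
- case=> -[t k] red; rewrite /act /= ?addrK ?subrK //.
    exact: (@bstepK false).
  exact: (@bstepK true).
- move=> [t k] _; rewrite act_cat (act_nseq _ _).1 /= bstep_addN.
  by rewrite (act_nseq _ _).1.
Qed.

Lemma bs_eq_run u v : u ~ v -> run u = run v.
Proof. by move/bs_eq_act; apply. Qed.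

(** Converse to invariance: the state reached by a word represents the same element, so [run]
    decides equality in the group. *)
Lemma wstate_step s x : wstate s ++ [:: x] ~ wstate (step s x).
Proof.
have ka t k l : wstate (t, k) ++ apow l ~ wstate (t, k + l).
  by rewrite /wstate -catA apowD.
suff kb e : wstate s ++ [:: bl e] ~ wstate (bstep N e s).
  case: x; [|  |exact: (kb false)|exact: (kb true)]; case: s {kb} => t k.
    exact: (ka t k 1).
  exact: (ka t k (-1)).
have pushE t k : wstate (t, k) ++ [:: bl e] ~
    wstate ((e, (k %% N)%Z) :: t, k - (k %% N)%Z).
  rewrite /wstate /= -!catA -apow_bl ?dvdz_subm // !catA.
  by rewrite -[(_ ++ apow _) ++ apow _]catA apowD addrC subrK.
case: s => -[|[e' r] t] k; first exact: pushE.
rewrite /bstep; case: ifP => [/andP[/eqP -> Nk]|_]; last exact: pushE.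
rewrite /wstate /= -!catA apow_bl // [[:: bl _] ++ _ ++ _]catA.
rewrite -[[:: bl _] ++ _]/[:: bl (~~ e); bl e].
by rewrite -{2}(negbK e) blC apowD.
Qed.

Lemma wstate_act s u : wstate s ++ u ~ wstate (act s u).
Proof.
elim: u s => [|x u IH] s; first by rewrite cats0.
by rewrite -cat1s catA wstate_step IH.
Qed.

Lemma wstate_run u : u ~ wstate (run u).
Proof. exact: (wstate_act ([::], 0)). Qed.

Lemma bs_eq_apow u k : u ~ apow k <-> run u = ([::], k).
Proof.
split=> [/bs_eq_run ->|uE]; first by rewrite /run act_apow add0r.
by have := wstate_run u; rewrite uE.
Qed.

Lemma run_bl e k : run (bl e :: apow k) = ([:: (e, 0)], k).
Proof.
rewrite -cat1s /run act_cat /act /= step_bl -/act act_apow /bstep /=.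
by rewrite mod0z subr0 add0r.
Qed.

Lemma bs_eq_bl u e k : u ~ bl e :: apow k <-> run u = ([:: (e, 0)], k).
Proof.
split=> [/bs_eq_run ->|uE]; first exact: run_bl.
by have := wstate_run u; rewrite uE.
Qed.

Lemma inHE u : inH N u <-> (run u).1 = [::].
Proof.
split=> [[k /bs_eq_apow -> //]|uE]; exists (run u).2.
by apply/bs_eq_apow; rewrite -uE; case: run.
Qed.

(** The relations preserve the exponent sum of a, which therefore recovers k from any word equal to
    a^k. *)
Lemma run_aexp u : (run u).1 = [::] -> run u = ([::], aexp u).
Proof.
move=> uE; have /bs_eq_apow uk : run u = ([::], (run u).2).
  by rewrite -uE; case: run.
by rewrite {1}(surjective_pairing (run u)) uE (aexp_bs_eq uk) aexp_apow.
Qed.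

End Run.

(** * Decomposition by the last excursion *)

Section Excursion.
Variable N : nat.
Hypothesis N_gt0 : (0 < N)%N.
Local Notation "u ~ v" := (bs_eq N u v) (at level 70).
Local Notation step := (step N).
Local Notation act := (act N).
Local Notation run := (run N).

Let N_neq0 : N%:Z != 0. Proof. by rewrite eqz_nat -lt0n. Qed.

Definition hit (S : pred (bool * int)) (t : seq (bool * int)) : bool :=
  if t is [:: p] then S p else false.

(* Closed paths of the Bass-Serre tree based at the vertex <a>, avoiding the
   neighbours [a^r b^e <a>] with [S (e, r)]. *)
Definition good (S : pred (bool * int)) (w : word) : bool :=
  `[< (run w).1 = [::] /\ forall i, ~~ hit S (run (take i w)).1 >].

Lemma good_run S w : good S w -> (run w).1 = [::].
Proof. by move/asboolP=> []. Qed.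

Lemma good_hit S w i : good S w -> ~~ hit S (run (take i w)).1.
Proof. by move/asboolP=> []. Qed.

Lemma good_take S w i :
  good S w -> (run (take i w)).1 = [::] -> good S (take i w).
Proof.
move=> gw wi; apply/asboolP; split=> // j.
by rewrite -take_min; exact: good_hit.
Qed.

Lemma goodH w : inH N w <-> good pred0 w.
Proof.
split=> [/(inHE N_gt0) w0|/good_run/(inHE N_gt0)//].
by apply/asboolP; split=> // i; case: (run _).1 => [|p []].
Qed.

(** A prefix representing b^e a^j is a visit to the neighbour b^e<a>. The sign [true] gives the
    words of L, [false] those of K. *)
Lemma good_avoidP e w :
  (inH N w /\ ~ (exists u v j, w = u ++ v /\ u ~ bl e :: apow j)) <->
  good (pred1 (e, 0)) w.
Proof.
split=> [[/(inHE N_gt0) w0 wN]|gw].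
  apply/asboolP; split=> // i; apply/negP => wi; apply: wN.
  exists (take i w), (drop i w), (run (take i w)).2; rewrite cat_take_drop.
  split=> //; apply/(bs_eq_bl N_gt0).
  by case: (run _) wi => -[|p []] //= k /eqP ->.
split=> [|[u [v [j [wE /(bs_eq_bl N_gt0) uE]]]]].
  by apply/(inHE N_gt0); apply: good_run gw.
by have := good_hit (size u) gw; rewrite wE take_size_cat // uE /= eqxx.
Qed.

Lemma bstep_nil e k :
  bstep N e ([::], k) = ([:: (e, (k %% N)%Z)], k - (k %% N)%Z).
Proof. by []. Qed.

(** The bottom entry of the stack is the edge by which the path left <a>; it can change only after
    the stack has emptied. *)
Lemma step_last p s x : s.1 != [::] -> (step s x).1 != [::] ->
  last p (step s x).1 = last p s.1.
Proof.
suff lastb e : s.1 != [::] -> (bstep N e s).1 != [::] ->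
    last p (bstep N e s).1 = last p s.1.
  by case: x => //; exact: lastb.
case: s => -[|[e' r] t] k //= _; rewrite /bstep; case: ifP => //= _.
by case: t.
Qed.

Lemma act_last p s u : (forall j, (act s (take j u)).1 != [::]) ->
  last p (act s u).1 = last p s.1.
Proof.
elim: u s => //= x u IH s sN; rewrite /act /= -/act IH.
  by apply: step_last; [exact: (sN 0%N) | have := sN 1%N; rewrite /= take0].
by move=> j; exact: (sN j.+1).
Qed.

(* The last excursion [b^e v b^-e] of [rcons w b^-e] starts at position [i]. *)
Definition arch (e : bool) (S : pred (bool * int)) (w : word) (i : nat) : bool :=
  [&& good S (take i w), ~~ S (e, (aexp (take i w) %% N)%Z), nth La w i == bl e,
      good (pred1 (~~ e, 0)) (drop i.+1 w) & (N %| aexp (drop i.+1 w))%Z].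

Lemma take_arch e S w i : (i < size w)%N -> arch e S w i ->
  take i.+1 w = take i w ++ [:: bl e].
Proof.
by move=> iw /and5P[_ _ /eqP we _ _]; rewrite (take_nth La) // we cats1.
Qed.

Lemma run_arch e S w i : (i < size w)%N -> arch e S w i ->
  run (take i.+1 w) = ([:: (e, (aexp (take i w) %% N)%Z)],
                       aexp (take i w) - (aexp (take i w) %% N)%Z).
Proof.
move=> iw ew; rewrite (take_arch iw ew) /run act_cat -/run.
case/and5P: ew => /good_run/(run_aexp N_gt0) -> _ _ _ _.
by rewrite /act /= step_bl bstep_nil.
Qed.

(** Otherwise some prefix of the inner word would lie in b^-e<a>, a neighbour that the path of this
    inner word avoids. *)
Lemma arch_neq_nil e S w i j : (i < size w)%N -> arch e S w i -> (i < j)%N ->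
  (run (take j w)).1 != [::].
Proof.
move=> iw ew ij; apply/eqP => /(run_aexp N_gt0)/(bs_eq_apow N_gt0).
rewrite -(subnKC ij) takeD (take_arch iw ew); set v := take _ (drop _ _) => wj.
have vg : ~~ hit (pred1 (~~ e, 0)) (run v).1.
  by apply: good_hit; case/and5P: ew.
move/negP: vg; apply.
case/and5P: ew => /good_run/(run_aexp N_gt0)/(bs_eq_apow N_gt0) wi _ _ _ _.
move: (aexp (_ ++ v)) wj => l; rewrite wi; move: (aexp _) => k wj.
suff /(bs_eq_bl N_gt0) -> : v ~ bl (~~ e) :: apow (l - k) by rewrite /= eqxx.
apply: (@bs_cancell N (apow k ++ [:: bl e])); rewrite wj.
rewrite -[bl (~~ e) :: _]/([:: bl (~~ e)] ++ _) -catA.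
by rewrite blCK apowD addrC subrK.
Qed.

Lemma take_rcons_le (w : word) x j :
  (j <= size w)%N -> take j (rcons w x) = take j w.
Proof. by move=> jw; rewrite -cats1 takel_cat. Qed.

Lemma bstep_nilP e s : (bstep N e s).1 = [::] ->
  exists2 r, s.1 = [:: (~~ e, r)] & (N %| s.2)%Z.
Proof.
case: s => -[|[e' r] t] k //; rewrite /bstep.
by case: ifP => //= /andP[/eqP -> Nk] ->; exists r.
Qed.

(** The inner word lies in <a^N>, so the closing letter pops the entry pushed by the opening one. Up
    to position [i] the prefix avoids [S]; afterwards the bottom entry stays outside [S]. *)
Lemma arch_good e S w i : (i < size w)%N -> arch e S w i ->
  good S (rcons w (bl (~~ e))).
Proof.
move=> iw ew; have ri := run_arch iw ew.
have wE : w = take i.+1 w ++ drop i.+1 w by rewrite cat_take_drop.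
have w0 : (run (rcons w (bl (~~ e)))).1 = [::].
  rewrite -cats1 /run act_cat {1}wE act_cat -/run ri.
  case/and5P: ew => _ _ _ /good_run/(run_aexp N_gt0)/(bs_eq_apow N_gt0) vE Nv.
  rewrite (bs_eq_act N_gt0 vE) /=; last by rewrite modz_bound // implybT.
  by rewrite act_apow (step_bl N _ (~~ e)) /bstep /= negbK eqxx rpredD // dvdz_subm.
apply/asboolP; split=> // j; case: (leqP j (size w)) => jw; last first.
  by rewrite take_oversize ?size_rcons // w0.
rewrite take_rcons_le //; case: (leqP j i) => ij.
  by rewrite -(minn_idPl ij) take_min; apply: good_hit; case/and5P: ew.
have vN l : (act (run (take i.+1 w)) (take l (drop i.+1 w))).1 != [::].
  rewrite -act_cat -takeD; apply: (arch_neq_nil iw ew).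
  by rewrite addSn ltnS leq_addr.
have /(act_last (e, 0)) : forall l, (act (run (take i.+1 w))
    (take l (take (j - i.+1) (drop i.+1 w)))).1 != [::].
  by move=> l; rewrite -take_min.
rewrite -act_cat -takeD subnKC // ri -/run.
case: (run _).1 => [|p []] //= ->; by case/and5P: ew.
Qed.

Lemma good_arch e S w : good S (rcons w (bl (~~ e))) ->
  exists2 i, (i < size w)%N & arch e S w i.
Proof.
move=> gw; have := good_run gw.
rewrite -cats1 /run act_cat -/run /act /= step_bl -/act.
move/bstep_nilP=> [r0]; rewrite negbK => rw Nw.
(* The opening position is the last visit of [w] to <a>, that is the maximal [i] satisfying [Q]. *)
pose Q j := (j <= size w)%N && ((run (take j w)).1 == [::]).
have Q0 : exists j, Q j by exists 0%N; rewrite /Q take0.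
have Qub j : Q j -> (j <= size w)%N by case/andP.
case: (ex_maxnP Q0 Qub) => i /andP[iw /eqP wi] imax {Q0 Qub}.
have jN j : (i < j)%N -> (run (take j w)).1 != [::].
  move=> ij; case: (leqP j (size w)) => jw.
    apply/negP => j0; have /imax : Q j by rewrite /Q jw.
    by rewrite leqNgt ij.
  by rewrite take_oversize ?rw // ltnW.
have {imax}iw : (i < size w)%N.
  rewrite ltn_neqAle iw andbT; apply: contra_eqN wi => /eqP ->.
  by rewrite take_size rw.
have gi : good S (take i w).
  move: wi; rewrite -(take_rcons_le (bl (~~ e)) (ltnW iw)) => wi.
  exact: good_take.
have := run_aexp N_gt0 wi; set k := aexp _ => runi.
have takeS : take i.+1 w = take i w ++ [:: nth La w i].
  by rewrite (take_nth La) // cats1.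
have runS : run (take i.+1 w) = step ([::], k) (nth La w i).
  by rewrite takeS /run act_cat -/run runi.
have [e' we] : exists e', nth La w i = bl e'.
  have := jN i.+1 (leqnn _); rewrite runS; case: (nth _ _ _) => //= _.
    by exists false.
  by exists true.
move: runS; rewrite we step_bl bstep_nil => runS.
have wE : w = take i.+1 w ++ drop i.+1 w by rewrite cat_take_drop.
(* The bottom entry survives until the end of [w], so the entry pushed at [i] is the one popped by
   the closing letter. *)
have e'E : e' = e /\ r0 = (k %% N)%Z.
  have vN l : (act (run (take i.+1 w)) (take l (drop i.+1 w))).1 != [::].
    by rewrite -act_cat -takeD jN // addSn ltnS leq_addr.
  have := act_last (e, 0) vN.
  by rewrite -act_cat -wE -/run runS rw /= => -[-> ->].
case: e'E => e'E r0E; subst e'.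
(* Cancelling the prefix through the opening letter shows that the inner word is a power of a. *)
have vE : drop i.+1 w ~ apow ((run w).2 - (k - (k %% N)%Z)).
  apply: (@bs_cancell N (take i.+1 w)); rewrite -wE.
  rewrite (wstate_run N (take _ w)) {1}(wstate_run N w) runS /wstate rw r0E /=.
  by rewrite -!catA apowD addrC subrK.
exists i => //; apply/and5P; split.
- exact: gi.
- have := good_hit i.+1 gw; rewrite take_rcons_le // runS.
  by [].
- by rewrite we.
- apply/asboolP; split=> [|l]; first by rewrite ((bs_eq_apow N_gt0 _ _).1 vE).
  apply/negP => vl.
  (* A visit of the inner word to b^-e<a> would bring [w] back to <a> after [i]. *)
  have [c /(bs_eq_bl N_gt0) vlE] :
      exists c, run (take l (drop i.+1 w)) = ([:: (~~ e, 0)], c).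
    by case: (run _) vl => -[|p []] //= c /eqP ->; exists c.
  have := jN (i.+1 + l)%N; rewrite addSn ltnS leq_addr => /(_ isT).
  rewrite -addSn takeD takeS we => /eqP; apply; apply/(inHE N_gt0).
  exists (k + c); rewrite vlE -apowD -catA.
  rewrite -[bl (~~ e) :: _]/([:: bl (~~ e)] ++ _) blCK.
  by rewrite -((bs_eq_apow N_gt0 _ _).2 runi).
- by rewrite (aexp_bs_eq vE) aexp_apow rpredB // dvdz_subm.
Qed.

End Excursion.

Section Arches.
Variable N : nat.
Hypothesis N_gt0 : (0 < N)%N.
Variable S : pred (bool * int).

Lemma good_nil : good N S [::].
Proof. by apply/asboolP; split=> // -[|i]. Qed.

Lemma good_rcons_a w x :
  (forall s, (step N s x).1 = s.1) -> good N S (rcons w x) = good N S w.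
Proof.
move=> xE; have wx : (run N (rcons w x)).1 = (run N w).1.
  by rewrite -cats1 /run act_cat /act /= xE.
apply/idP/idP => /asboolP[w0 wh]; apply/asboolP; split=> [|i].
- by rewrite -wx.
- case: (leqP i (size w)) => iw; first by rewrite -(take_rcons_le x iw).
  by rewrite take_oversize ?(ltnW iw) // -wx w0.
- by rewrite wx.
- case: (leqP i (size w)) => iw; first by rewrite take_rcons_le.
  by rewrite take_oversize ?size_rcons // wx w0.
Qed.

(** The opening position is unique: of two candidates, the later one would be a return to <a> after
    the earlier opening. *)
Lemma sum_arch e w :
  (\sum_(i < size w) arch N e S w i)%N = good N S (rcons w (bl (~~ e))).
Proof.
case: (boolP (good _ _ _)) => [/(good_arch N_gt0)[i iw wi]|wN] /=; last first.
  rewrite big1 // => i _; case: (boolP (arch _ _ _ _ _)) => // wi.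
  by rewrite (arch_good N_gt0 (ltn_ord i) wi) in wN.
rewrite (bigD1 (Ordinal iw)) //= wi big1 // => j; rewrite -val_eqE /= => ji.
case: (boolP (arch _ _ _ _ _)) => // wj.
have arch_nil k : arch N e S w k -> (run N (take k w)).1 = [::].
  by case/and5P=> /good_run.
move: ji; rewrite neq_ltn => /orP[ji|ij].
  by have := arch_neq_nil N_gt0 (ltn_ord j) wj ji; rewrite arch_nil.
by have := arch_neq_nil N_gt0 iw wi ij; rewrite arch_nil.
Qed.

End Arches.

(** * Convolution and the unambiguous decomposition of closed paths *)

Definition conv (f g : word -> nat) (w : word) : nat :=
  (\sum_(i < (size w).+1) f (take i w) * g (drop i w))%N.

Definition single (u w : word) : nat := w == u.

Lemma conv_singler f x :
  (conv f (single [:: x]) [::] = 0%N) *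
  (forall w y, conv f (single [:: x]) (rcons w y) = ((y == x) * f w)%N).
Proof.
split=> [|w y]; first by rewrite /conv big_ord1 /single muln0.
have lt_w : (size w < (size (rcons w y)).+1)%N by rewrite size_rcons ltnS.
rewrite /conv (bigD1 (Ordinal lt_w)) //= big1 ?addn0; last first.
  move=> i; rewrite -val_eqE /= => iw.
  rewrite /single; case: (_ =P [:: x]) => [/(congr1 size)/=|]; last by rewrite muln0.
  by move/eqP: iw; rewrite size_drop; have := size_rcons w y; lia.
rewrite take_rcons_le // take_size -cats1 drop_size_cat // mulnC.
by rewrite /single eqseq_cons eqxx andbT.
Qed.

Lemma conv_singlel f x :
  (conv (single [:: x]) f [::] = 0%N) *
  (forall w y, conv (single [:: x]) f (y :: w) = ((y == x) * f w)%N).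
Proof.
split=> [|w y]; first by rewrite /conv big_ord1 mul0n.
rewrite /conv big_ord_recl /= big_ord_recl /= take0 drop0 big1 ?addn0.
  by rewrite /single eqseq_cons eqxx andbT.
move=> i _; rewrite /= /single; case: (_ =P [:: x]) => // -[_] /(congr1 size) /=.
by rewrite size_take_min /bump; have := ltn_ord i; lia.
Qed.

Lemma conv_arch N e S w x :
  conv (fun u => good N S u && ~~ S (e, (aexp u %% N)%Z))
    (conv (single [:: bl e])
       (conv (fun u => good N (pred1 (~~ e, 0%R)) u && (N %| aexp u)%Z)
          (single [:: bl (~~ e)]))) (rcons w x) =
  ((x == bl (~~ e)) * \sum_(i < size w) arch N e S w i)%N.
Proof.
(* The last two cuts leave at most one letter, too few for both b^e and b^-e, so they contribute
   0. *)
rewrite {1}/conv size_rcons !big_ord_recr /= take_rcons_le // -{4}cats1.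
rewrite drop_size_cat // drop_oversize ?size_rcons //.
rewrite !conv_singlel (conv_singler _ _).1 !muln0 !addn0 big_distrr /=.
apply: eq_bigr => i _; rewrite take_rcons_le 1?ltnW //.
rewrite drop_rcons 1?ltnW // (drop_nth La) // rcons_cons.
rewrite conv_singlel conv_singler /arch andbA mulnCA.
by rewrite !mulnb; congr (nat_of_bool _); rewrite andbCA; do !bool_congr.
Qed.

(** Equating multiplicities rather than membership records that the decomposition is unique, so
    convolutions become products of series without overcounting. *)
Lemma good_decomposition N S w : (0 < N)%N ->
  good N S w = ((w == [::]) + conv (good N S) (single [:: La]) w +
    conv (good N S) (single [:: LaV]) w +
    \sum_(e : bool)
      conv (fun u => good N S u && ~~ S (e, (aexp u %% N)%Z))
        (conv (single [:: bl e])
           (conv (fun u => good N (pred1 (~~ e, 0%R)) u && (N %| aexp u)%Z)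
              (single [:: bl (~~ e)]))) w)%N :> nat.
Proof.
move=> N_gt0; case: (lastP w) => [|{}w x].
  by rewrite good_nil !conv_singler big1 // => e _; rewrite {1}/conv big_ord1 /=
    conv_singlel muln0.
rewrite !conv_singler big_bool /= !conv_arch !sum_arch //.
have -> : (rcons w x == [::]) = false by case: (w).
by case: x; rewrite /= ?(@good_rcons_a _ _ _ La) ?(@good_rcons_a _ _ _ LaV);
  rewrite ?mul1n ?addn0 ?add0n.
Qed.

(** * Generating functions of languages *)

Lemma fcoef_sum (R : comNzRingType) (I : Type) (r : seq I) (P : pred I)
    (F : I -> fps R) n :
  (\sum_(i <- r | P i) F i) n = \sum_(i <- r | P i) F i n.
Proof. by elim/big_rec2: _ => [|i x y _ <- //]; case: n. Qed.

Section Language.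
Variable R : comNzRingType.

Lemma lcoefD (f g : laurent R) k : (f + g) k = f k + g k.
Proof. by []. Qed.

Lemma lcoef0 k : (0 : laurent R) k = 0.
Proof. by rewrite -[LHS]/(if k == 0 then 0 else 0); case: ifP. Qed.

Lemma lcoef_sum (I : Type) (r : seq I) (P : pred I) (F : I -> laurent R) k :
  (\sum_(i <- r | P i) F i) k = \sum_(i <- r | P i) F i k.
Proof.
by elim/big_rec2: _ => [|i x y _ <-]; [exact: lcoef0 | exact: lcoefD].
Qed.

Lemma lmonoE c k i : lmono c k i = if i == k then c else 0 :> R.
Proof. by []. Qed.

Lemma lmonoM (a b : R) i j : lmono a i * lmono b j = lmono (a * b) (i + j).
Proof.
apply: laurentP => k; rewrite lcoefM (@fsbigTE _ _ _ _ [fset i]%fset) /=.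
  rewrite big_seq_fset1 eqxx subr_eq [(j + i)%R]addrC.
  by case: ifP => // _; rewrite mulr0.
by move=> m; rewrite inE => /negPf ->; rewrite mul0r.
Qed.

Definition weight (w : word) : laurent R := lmono 1 (aexp w).

Lemma weight_cat u v : weight (u ++ v) = weight u * weight v.
Proof. by rewrite /weight lmonoM mulr1 aexp_cat. Qed.

(** The weight uses the exponent sum, defined for all words and additive under concatenation; this
    makes convolution correspond to the product even for pieces outside H. *)
Definition langfun (f : word -> nat) : fps (laurent R) :=
  Fps (fun n => \sum_(w : n.-tuple letter) weight w *+ f w).

Lemma eq_langfun f g : f =1 g -> langfun f = langfun g.
Proof. by move=> fg; apply: fpsP => n; apply: eq_bigr => w _; rewrite fg. Qed.

Lemma langfunD f g : langfun (fun w => f w + g w)%N = langfun f + langfun g.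
Proof.
apply: fpsP => n /=; rewrite -[RHS]/(langfun f n + langfun g n) /= -big_split.
by apply: eq_bigr => w _; rewrite mulrnDr.
Qed.

Lemma langfun_sum (I : finType) (f : I -> word -> nat) :
  langfun (fun w => \sum_i f i w)%N = \sum_i langfun (f i).
Proof.
apply: fpsP => n; rewrite fcoef_sum exchange_big.
by apply: eq_bigr => w _; rewrite -sumrMnr.
Qed.

Lemma big_tuple_cat (V : nmodType) m n (F : word -> V) :
  \sum_(w : (m + n).-tuple letter) F w =
  \sum_(u : m.-tuple letter) \sum_(v : n.-tuple letter) F (u ++ v).
Proof.
rewrite pair_bigA /=.
pose h (p : m.-tuple letter * n.-tuple letter) := [tuple of p.1 ++ p.2].
rewrite (reindex h) //=; apply/onW_bij/inj_card_bij.
  move=> [u v] [u' v'] /(congr1 val)/eqP /=.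
  by rewrite eqseq_cat ?size_tuple // => /andP[/eqP/val_inj -> /eqP/val_inj ->].
by rewrite card_prod !card_tuple expnD.
Qed.

Lemma langfunM_coef f g i m :
  \sum_(w : (i + m).-tuple letter)
    weight w *+ (f (take i w) * g (drop i w))%N = langfun f i * langfun g m.
Proof.
rewrite (big_tuple_cat _ _ (fun w => weight w *+ (f (take i w) * g (drop i w))%N)).
rewrite big_distrl /=; apply: eq_bigr => u _; rewrite big_distrr /=.
apply: eq_bigr => v _; rewrite take_size_cat ?drop_size_cat ?size_tuple //.
by rewrite weight_cat mulrnAl mulrnAr -mulrnA mulnC.
Qed.

Lemma langfunM f g : langfun f * langfun g = langfun (conv f g).
Proof.
apply: fpsP => n; rewrite fcoefM.
have -> : langfun (conv f g) n = \sum_(w : n.-tuple letter) \sum_(i < n.+1)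
    weight w *+ (f (take i w) * g (drop i w))%N.
  by apply: eq_bigr => w _; rewrite /conv -sumrMnr size_tuple.
rewrite exchange_big; apply: eq_bigr => i _.
by rewrite -langfunM_coef subnKC // -ltnS ltn_ord.
Qed.

Lemma langfun_single u :
  langfun (single u) = Fps (fun n => if n == size u then weight u else 0).
Proof.
apply: fpsP => n /=; case: eqP => [->|nu].
  rewrite (bigD1 (in_tuple u)) //= /single eqxx mulr1n big1 ?addr0 // => w.
  by rewrite -val_eqE /= => /negPf ->.
rewrite big1 // => w _; rewrite /single; case: (_ =P u) => // wu.
by case: nu; rewrite -wu size_tuple.
Qed.

Lemma langfun_nil : langfun (single [::]) = 1.
Proof.
rewrite langfun_single; apply: fpsP => n /=; rewrite /weight /aexp big_nil.
by [].
Qed.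

Lemma fcoefXM (f : fps (laurent R)) n :
  (fpsX (laurent R) * f) n = if n is m.+1 then f m else 0.
Proof.
rewrite fcoefM; case: n => [|n]; first by rewrite big_ord1 /= mul0r.
rewrite big_ord_recl /= mul0r add0r big_ord_recl /= mul1r subSS subn0.
by rewrite big1 ?addr0 // => i _; rewrite mul0r.
Qed.

Lemma langfun_letter x :
  langfun (single [:: x]) = fpsX (laurent R) * fpsC (lmono 1 (aexp [:: x])).
Proof.
rewrite langfun_single; apply: fpsP => n; rewrite fcoefXM.
by case: n => [|[|n]].
Qed.

Lemma aexp1 x :
  aexp [:: x] = match x with La => 1 | LaV => -1 | _ => 0 end.
Proof. by rewrite /aexp big_cons big_nil addr0. Qed.

Lemma langfun_bl e : langfun (single [:: bl e]) = fpsX (laurent R).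
Proof.
by rewrite langfun_letter aexp1; case: e; exact: mulr1.
Qed.

End Language.

(** * Series of closed paths and of excursions *)

Section GeneratingFunctions.
Variables (R : comNzRingType) (N : nat).
Hypothesis N_gt0 : (0 < N)%N.

(** A word of H represents a^k exactly for k = [aexp w], so sorting by k leaves one term per
    word. *)
Lemma genfun_langfun (A : word -> Prop) (a : pred word) :
  (forall w, A w -> inH N w) -> (forall w, A w <-> a w) ->
  genfun R N A = langfun R a.
Proof.
move=> AH Aa; apply: fpsP => n; apply: laurentP => k; rewrite lcoef_sum.
rewrite [LHS]/= /nwords cardsE -sum1_card natr_sum big_mkcond /=.
apply: eq_bigr => w _.
have -> : (w \in [pred w0 : n.-tuple letter |
    `[< A w0 /\ bs_eq N w0 (apow k) >]]) = a w && (k == aexp w).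
  apply/asboolP/andP => [[/Aa aw /aexp_bs_eq ->]|[/Aa Aw /eqP ->]].
    by rewrite aexp_apow.
  by split=> //; have [l wl] := AH _ Aw; rewrite (aexp_bs_eq wl) aexp_apow.
by case: (a w); rewrite /= ?mulr0n ?mulr1n ?lcoef0 ?lmonoE; case: (k == _).
Qed.

Lemma lphiE d (f : laurent R) k : d != 0 ->
  lphi d d f k = if (d %| k)%Z then f k else 0.
Proof.
(* [A] contains every j with [f (d * j)] nonzero, which makes the defining sum over the integers
   finite. *)
move=> d0; pose A := [fset (k %/ d)%Z | k in lsupp f]%fset.
have fA j : j \notin A -> f (d * j) = 0.
  move=> jA; apply: lsupp0; apply: contra jA => jf.
  by apply/imfsetP; exists (d * j) => //=; rewrite mulKz.
rewrite /lphi (@fsbigTE _ _ _ _ A); last first.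
  move=> j /fA ->; apply: laurentP => i.
  by rewrite lmonoE lcoef0; case: ifP.
rewrite lcoef_sum; case: ifP => [/dvdzP[j ->]|kN]; last first.
  apply: big1 => j _; rewrite lmonoE; case: eqP => // kE.
  by rewrite kE dvdz_mulr in kN.
rewrite [j * d]mulrC; case: (boolP (j \in A)) => jA.
  rewrite (big_fsetD1 j) // big_seq big1 => [|i]; first by rewrite /= eqxx addr0.
  rewrite !inE => /andP[ij _]; rewrite lmonoE (inj_eq (mulfI d0)) eq_sym.
  by rewrite (negPf ij).
rewrite fA // big_seq big1 // => i iA; rewrite lmonoE (inj_eq (mulfI d0)).
by case: eqP => // ji; rewrite ji iA in jA.
Qed.

Let N_neq0 : N%:Z != 0. Proof. by rewrite eqz_nat -lt0n. Qed.

Lemma Phi_langfun (a : pred word) :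
  Phi N N (langfun R a) = langfun R (fun w => a w && (N %| aexp w)%Z).
Proof.
apply: fpsP => n; apply: laurentP => k.
rewrite [LHS](lphiE _ _ N_neq0) !lcoef_sum.
have wtE (w : word) (b : nat) :
    (weight R w *+ b) k = if k == aexp w then b%:R else 0.
  elim: b => [|b IH]; first by rewrite lcoef0; case: ifP.
  rewrite mulrS lcoefD IH lmonoE; case: ifP => _; last by rewrite addr0.
  by rewrite mulrS.
case: ifP => Nk; [apply: eq_bigr | symmetry; apply: big1] => w _;
  rewrite !wtE; case: eqP => // kE; rewrite -kE Nk ?andbT ?andbF //.
Qed.

(** The series of inner words of excursions: L_0 for the sign [true], K_0 for [false]. *)
Definition excfun e : fps (laurent R) :=
  langfun R (fun w => good N (pred1 (e, 0)) w && (N %| aexp w)%Z).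

(** The letters b^e and b^-e of an excursion contribute z^2, and its inner word avoids b^-e<a>,
    whence [excfun (~~ e)]. *)
Lemma langfun_good S :
  let z := fpsX (laurent R) in
  let q k : fps (laurent R) := fpsC (lmono 1 k) in
  langfun R (good N S) = 1 + z * (q 1 + q (-1)) * langfun R (good N S) +
    z ^+ 2 * \sum_(e : bool)
      langfun R (fun w => good N S w && ~~ S (e, (aexp w %% N)%Z)) *
      excfun (~~ e).
Proof.
move=> z q; set F := langfun R (good N S).
rewrite [LHS](eq_langfun _ (good_decomposition S ^~ N_gt0)).
rewrite !langfunD langfun_sum !big_bool -!langfunM.
rewrite langfun_nil !langfun_bl !langfun_letter !aexp1 -/F -/z.
by rewrite /excfun /q /=; ring.
Qed.

(** * The automorphism fixing a and inverting b *)

Definition swapb (x : letter) : letter :=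
  match x with Lb => LbV | LbV => Lb | _ => x end.

Definition swap_stack := map (fun p : bool * int => (~~ p.1, p.2)).

Lemma act_swapb t k w : act N (swap_stack t, k) (map swapb w) =
  (swap_stack (act N (t, k) w).1, (act N (t, k) w).2).
Proof.
have bE e l m : bstep N (~~ e) (swap_stack l, m) =
    (swap_stack (bstep N e (l, m)).1, (bstep N e (l, m)).2).
  rewrite /bstep; case: l => //= -[e' r] l /=.
  by rewrite (inj_eq negb_inj); case: ifP.
elim: w t k => //= x w IH t k; case: x; rewrite /act /= -/(act N) //.
  by rewrite (bE false) IH; case: bstep.
by rewrite (bE true) IH; case: bstep.
Qed.

Lemma run_swapb w :
  run N (map swapb w) = (swap_stack (run N w).1, (run N w).2).
Proof. exact: (act_swapb [::]). Qed.

Lemma good_swapb e w :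
  good N (pred1 (e, 0)) (map swapb w) = good N (pred1 (~~ e, 0)) w.
Proof.
have hitE t : hit (pred1 (e, 0)) (swap_stack t) = hit (pred1 (~~ e, 0)) t.
  by case: t => [|[e' r] []] //=; rewrite !xpair_eqE; case: e e' => [] [].
apply/asboolP/asboolP; rewrite run_swapb /= => -[w0 wh]; split=> [|i].
- by case: (run N w).1 w0.
- by rewrite -hitE; have := wh i; rewrite -map_take run_swapb.
- by rewrite w0.
- by rewrite -map_take run_swapb hitE.
Qed.

Lemma langfun_swapb (f : word -> nat) :
  langfun R (fun w => f (map swapb w)) = langfun R f.
Proof.
apply: fpsP => n /=; rewrite [RHS](reindex (fun w => map_tuple swapb w)) /=.
  apply: eq_bigr => w _; congr (lmono _ _ *+ _).
  by rewrite /aexp big_map; apply: eq_bigr => -[].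
by exists (fun w => map_tuple swapb w) => w _; apply: val_inj;
  rewrite /= -map_comp -[RHS]map_id; apply: eq_map => -[].
Qed.

Lemma langfun_good_swap e :
  langfun R (good N (pred1 (~~ e, 0))) = langfun R (good N (pred1 (e, 0))).
Proof.
rewrite -[RHS]langfun_swapb; apply: eq_langfun => w.
by rewrite good_swapb.
Qed.

Lemma excfun_swap e : excfun (~~ e) = excfun e.
Proof.
rewrite /excfun -[RHS]langfun_swapb; apply: eq_langfun => w.
rewrite good_swapb; congr (_ && (_ %| _)%Z).
by rewrite /aexp big_map; apply: eq_bigr => -[].
Qed.

End GeneratingFunctions.

(** * Roots of unity and algebraicity *)

Section Omega.
Variables (R : realType) (N : nat).
Hypothesis N_gt0 : (0 < N)%N.
Local Notation w := (omega R N).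

Lemma omegaX n : w ^+ n =
  (cos (2 * pi / N%:R * n%:R) +i* sin (2 * pi / N%:R * n%:R))%C.
Proof.
rewrite /omega; set c := 2 * pi / N%:R.
elim: n => [|n IH]; first by rewrite mulr0 cos0 sin0.
rewrite exprSr IH -natr1 mulrDr mulr1 cosD sinD.
by congr (_ +i* _)%C; rewrite addrC mulrC [X in _ + X]mulrC.
Qed.

Lemma omegaXN : w ^+ N = 1.
Proof.
by rewrite omegaX divfK ?pnatr_eq0 -?lt0n // mulr_natl cos2pi sin2pi.
Qed.

Lemma omegaX_neq1 n : (0 < n < N)%N -> w ^+ n != 1.
Proof.
case/andP=> n_gt0 nN; rewrite omegaX; apply/negP => /eqP[cos1 _].
(* As y lies strictly between 0 and pi, cos (2 y) = 1 would force the positive number sin y to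
   vanish. *)
pose y : R := pi / N%:R * n%:R.
have N0 : (0 : R) < N%:R by rewrite ltr0n.
have y_bd : 0 < y < pi.
  rewrite /y !mulr_gt0 ?invr_gt0 ?pi_gt0 ?ltr0n //=.
  by rewrite -mulrA gtr_pMr ?pi_gt0 // mulrC ltr_pdivrMr // mul1r ltr_nat.
have := sin_gt0_pi y_bd; suff -> : sin y = 0 by rewrite ltxx.
apply/eqP; rewrite -sqrf_eq0 sin2cos2 subr_eq0 eq_sym; apply/eqP.
move: cos1; have -> : 2 * pi / N%:R * n%:R = y *+ 2 by rewrite /y; ring.
by rewrite cos_mulr2n; lra.
Qed.

Lemma omega_neq0 : w != 0.
Proof.
by apply: contra_eq_neq omegaXN => ->; rewrite expr0n gtn_eqF // eq_sym oner_neq0.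
Qed.

Lemma omegaz_eq1 k : (w ^ k == 1) = (N %| k)%Z.
Proof.
have N0 : N%:Z != 0 by rewrite eqz_nat -lt0n.
rewrite {1}(divz_eq k N) expfzDr ?omega_neq0 // mulrC [_ * N%:Z]mulrC -exprz_exp.
rewrite -[w ^ N%:Z]/(w ^+ N) omegaXN exp1rz mulr1.
rewrite (sameP dvdz_mod0P eqP).
have := modz_ge0 k N0; have := ltz_mod k N0.
case: (_ %% _)%Z => // r /= rN _; rewrite -[w ^ r]/(w ^+ r).
case: r rN => [|r] rN; first by rewrite expr0 !eqxx.
by rewrite (negPf (omegaX_neq1 _)).
Qed.

(** This is a geometric sum whose ratio [w ^ k] is an N-th root of unity, equal to 1 exactly when N
    divides k. *)
Lemma sum_omega k :
  \sum_(j < N) (w ^+ j) ^ k = if (N %| k)%Z then N%:R else 0.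
Proof.
have -> : \sum_(j < N) (w ^+ j) ^ k = \sum_(j < N) (w ^ k) ^+ j.
  by apply: eq_bigr => j _; exact: (exprzAC w j k).
rewrite -omegaz_eq1; case: eqP => [->|/eqP wk].
  under eq_bigr do rewrite expr1n.
  by rewrite sumr_const card_ord.
apply: (mulfI (_ : w ^ k - 1 != 0)); first by rewrite subr_eq0.
rewrite -subrX1 mulr0 -[_ ^+ N]/((w ^ k) ^ N%:Z) exprzAC.
by rewrite -[w ^ N%:Z]/(w ^+ N) omegaXN exp1rz subrr.
Qed.

End Omega.

(** * The substitution of u q for q as a ring morphism *)

Section Subst.
Variable F : fieldType.
Implicit Types (u : F) (f g : laurent F).

Lemma lsubstE u f k : lsubst u f k = f k * u ^ k.
Proof. by []. Qed.

Lemma lsubstB u f g : lsubst u (f - g) = lsubst u f - lsubst u g.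
Proof.
by apply: laurentP => k; rewrite -[RHS]/(f k * u ^ k - g k * u ^ k) -mulrBl.
Qed.

Lemma lsubst_mono u c k : lsubst u (lmono c k) = lmono (c * u ^ k) k.
Proof.
apply: laurentP => i; rewrite lsubstE !lmonoE.
by case: eqP => [->|]; rewrite ?mul0r.
Qed.

Lemma lsubstM u f g : u != 0 -> lsubst u (f * g) = lsubst u f * lsubst u g.
Proof.
move=> u0; apply: laurentP => k; rewrite lsubstE !lcoefM.
rewrite (@lconvE _ (lsupp f) f); last exact: lsupp0.
rewrite (@lconvE _ (lsupp f) (lsubst u f)) => [|i /lsupp0]; last first.
  by rewrite lsubstE => ->; rewrite mul0r.
rewrite big_distrl /=; apply: eq_bigr => i _.
by rewrite mulrACA -expfzDr // subrKC.
Qed.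

Lemma qsubst_zmod_morphism u : zmod_morphism (qsubst u).
Proof. by move=> f g; apply: fpsP => n; exact: (lsubstB u (f n) (g n)). Qed.

Lemma lsubst0 u : lsubst u 0 = 0.
Proof. by apply: laurentP => k; rewrite lsubstE lcoef0 mul0r. Qed.

Lemma qsubstC u c : qsubst u (fpsC c) = fpsC (lsubst u c).
Proof. by apply: fpsP => -[|n] //=; exact: lsubst0. Qed.

Lemma qsubst1 u : qsubst u 1 = 1.
Proof. by rewrite [LHS]qsubstC lsubst_mono expr0z mulr1. Qed.

Lemma qsubst_monoid_morphism u : u != 0 -> monoid_morphism (qsubst u).
Proof.
move=> u0; split=> [|f g]; first exact: qsubst1.
apply: fpsP => n; rewrite -[LHS]/(lsubst u ((f * g) n)) !fcoefM.
elim/big_rec2: _ => [|i x y _ <-]; first exact: lsubst0.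
have lsubstD a b : lsubst u (a + b) = lsubst u a + lsubst u b.
  by rewrite -[b in LHS]opprK lsubstB -sub0r lsubstB lsubst0 sub0r opprK.
by rewrite lsubstD lsubstM.
Qed.

Lemma qsubstX u : qsubst u (fpsX (laurent F)) = fpsX (laurent F).
Proof.
apply: fpsP => -[|[|n]] /=; try exact: lsubst0.
by rewrite [LHS]lsubst_mono expr0z mulr1.
Qed.

End Subst.

(** * Algebraicity by clearing denominators *)

Section FpsOfPoly.
Variable R : comNzRingType.

Lemma fps_of_poly_zmod : zmod_morphism (@fps_of_poly R).
Proof. by move=> p r; apply: fpsP => n /=; rewrite coefB. Qed.

Lemma fps_of_poly_monoid : monoid_morphism (@fps_of_poly R).
Proof.
split=> [|p r]; apply: fpsP => n /=; last by rewrite coefM.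
by rewrite coef1; case: n.
Qed.

HB.instance Definition _ :=
  GRing.isZmodMorphism.Build _ _ (@fps_of_poly R) fps_of_poly_zmod.
HB.instance Definition _ :=
  GRing.isMonoidMorphism.Build _ _ (@fps_of_poly R) fps_of_poly_monoid.

Lemma fps_of_polyC (c : R) : fps_of_poly c%:P = fpsC c.
Proof. by apply: fpsP => n /=; rewrite coefC. Qed.

Lemma fps_of_polyX : fps_of_poly 'X = fpsX R.
Proof. by apply: fpsP => n /=; rewrite coefX. Qed.

(** The outer variable of [P] stands for Y, the inner one for z. [P] arises on multiplying by all
    denominators, which are units since their constant coefficients are 1. *)
Lemma sum_fraction_algebraic n (a : 'I_n -> {poly R}) (b c : {poly R})
    (Y : fps R) :
  n%:R != 0 :> R -> (forall j, (a j)`_0 = 1) -> b`_0 = 0 -> c`_0 = 0 ->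
  n%:R * Y = \sum_(j < n) (1 - fps_of_poly b * Y ^+ 2) /
               (fps_of_poly (a j) - fps_of_poly c * Y) ->
  exists P : {poly {poly R}},
    P != 0 /\ (map_poly (@fps_of_poly R) P).[Y] = 0.
Proof.
move=> n0 a0 b0 c0 YE.
pose D j : {poly {poly R}} := (a j)%:P - c%:P * 'X.
pose P : {poly {poly R}} := n%:R * 'X * \prod_j D j -
  \sum_j (1 - b%:P * 'X ^+ 2) * \prod_(i | i != j) D i.
exists P; split.
  have horner00 j : (D j).[0].[0] = 1.
    by rewrite /D !hornerE subr0 horner_coef0 a0.
  (* At Y = 0 and z = 0 the first term vanishes and each of the n summands is 1, so [P] takes the
     value -n. *)
  apply/eqP => /(congr1 (fun p : {poly {poly R}} => p.[0].[0])).
  rewrite /P !hornerE !horner_sum (eq_bigr (fun=> 1)) => [|j _].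
    by rewrite sumr_const card_ord => /eqP; rewrite oppr_eq0 (negPf n0).
  rewrite !hornerE /= ?mulr0 ?subr0 ?mul1r !horner_prod.
  by rewrite big1 // => i _; exact: horner00.
pose ev := GRing.RMorphism.clone _ _
  (horner_eval Y \o map_poly (@fps_of_poly R)) _.
have evC p : ev p%:P = fps_of_poly p.
  by rewrite /= map_polyC /horner_eval hornerC.
have evX : ev 'X = Y by rewrite /= map_polyX /horner_eval hornerX.
have DE j : ev (D j) = fps_of_poly (a j) - fps_of_poly c * Y.
  by rewrite rmorphB rmorphM !evC evX.
have Dunit j : ev (D j) \is a GRing.unit.
  apply: fps_unit1; rewrite DE -[LHS]/((a j)`_0 - (fps_of_poly c * Y) 0%N).
  by rewrite a0 fcoefM big_ord1 /= c0 mul0r subr0.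
rewrite -[LHS]/(ev P) rmorphB rmorphM rmorphM rmorph_nat evX YE.
rewrite rmorph_sum rmorph_prod big_distrl -sumrB big1 // => j _.
rewrite rmorphM rmorphB rmorph1 rmorphM rmorphXn evC evX rmorph_prod -DE.
by rewrite (bigD1 j) //= mulrA (divrK (Dunit j)) subrr.
Qed.

End FpsOfPoly.

Lemma lcoefMn (R : comNzRingType) (f : laurent R) n k : (f *+ n) k = f k *+ n.
Proof.
by elim: n => [|n IH]; [exact: lcoef0 | rewrite !mulrS lcoefD IH].
Qed.

Lemma fcoefMn (R : comNzRingType) (f : fps R) n k : (f *+ n) k = f k *+ n.
Proof.
elim: n => [|n IH]; first by case: k.
by rewrite !mulrS -[LHS]/(f k + (f *+ n) k) IH.
Qed.

(** * The functional equations for G and L *)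

Section Equations.
Variables (R : comNzRingType) (N : nat).
Hypothesis N_gt0 : (0 < N)%N.

Let z := fpsX (laurent R).
Let q k : fps (laurent R) := fpsC (lmono 1 k).
Let L0 := excfun R N true.

Lemma genfunH : genfun R N (inH N) = langfun R (good N pred0).
Proof. by apply: genfun_langfun => // w; exact: goodH. Qed.

Lemma genfunL : genfun R N (inL N) = langfun R (good N (pred1 (true, 0))).
Proof.
by apply: genfun_langfun => // w; [case | exact: (good_avoidP N_gt0 true)].
Qed.

Lemma genfunK : genfun R N (inK N) = langfun R (good N (pred1 (false, 0))).
Proof.
by apply: genfun_langfun => // w; [case | exact: (good_avoidP N_gt0 false)].
Qed.

(** With [S] empty no excursion is excluded, and both signs contribute L_0 by symmetry. *)
Lemma langfunH_eq (G := langfun R (good N pred0)) :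
  G = 1 + z * (q 1 + q (-1)) * G + 2 * z ^+ 2 * G * L0.
Proof.
have GE e : langfun R (fun w => good N pred0 w &&
    ~~ pred0 (e, (aexp w %% N)%Z)) = G.
  by apply: eq_langfun => w; rewrite andbT.
rewrite {1}/G (langfun_good R N_gt0) -/G big_bool !GE /=.
by rewrite -[excfun _ _ false]excfun_swap -/L0 /q /z; ring.
Qed.

Lemma langfunL_eq (L := langfun R (good N (pred1 (true, 0)))) :
  L = 1 + z * (q 1 + q (-1)) * L + 2 * z ^+ 2 * L * L0 - z ^+ 2 * L0 ^+ 2.
Proof.
(* The letter b^-1 leads from <a> to b^-1<a> exactly after a prefix in <a^N>. Removing these
   prefixes leaves L - L_0, whose product with L_0 yields the correction term. *)
have L1 : langfun R (fun w => good N (pred1 (true, 0)) w &&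
    ~~ pred1 (true, 0) (true, (aexp w %% N)%Z)) = L - L0.
  apply/eqP; rewrite eq_sym subr_eq -langfunD; apply/eqP/eq_langfun => w.
  rewrite /= xpair_eqE eqxx (sameP eqP dvdz_mod0P).
  by case: good; case: (_ %| _)%Z.
have L2 : langfun R (fun w => good N (pred1 (true, 0)) w &&
    ~~ pred1 (true, 0) (false, (aexp w %% N)%Z)) = L.
  by apply: eq_langfun => w; rewrite andbT.
rewrite {1}/L (langfun_good R N_gt0) -/L big_bool L1 L2 /=.
by rewrite -[excfun _ _ false]excfun_swap -/L0 /q /z; ring.
Qed.

End Equations.

(** * Averaging over the N-th roots of unity *)

Section Averaging.
Variables (R : realType) (N : nat).
Hypothesis N_gt0 : (0 < N)%N.
Local Notation C := R[i].
Local Notation w := (omega R N).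
Let N_neq0 : N%:Z != 0. Proof. by rewrite eqz_nat -lt0n. Qed.

Lemma PhiE (f : fps (laurent C)) n k :
  Phi N N f n k = if (N %| k)%Z then f n k else 0.
Proof. exact: lphiE. Qed.

(** By [sum_omega], summing multiplies the coefficient of q^k by N if N divides k and by 0
    otherwise. *)
Lemma sum_qsubst_omega (f : fps (laurent C)) :
  N%:R * Phi N N f = \sum_(j < N) qsubst (w ^+ j) f.
Proof.
apply: fpsP => n; apply: laurentP => k.
rewrite mulr_natl fcoefMn lcoefMn PhiE fcoef_sum lcoef_sum.
rewrite [RHS](eq_bigr (fun j : 'I_N => f n k * (w ^+ j) ^ k)) //.
rewrite -big_distrr /= sum_omega //.
by case: ifP => _; rewrite ?mulr0 ?mul0rn // mulr_natr.
Qed.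

Lemma qsubst_omega_Phi (f : fps (laurent C)) j :
  qsubst (w ^+ j) (Phi N N f) = Phi N N f.
Proof.
apply: fpsP => n; apply: laurentP => k; rewrite [LHS]lsubstE.
rewrite PhiE; case: ifPn => Nk; last by rewrite mul0r.
rewrite -[w ^+ j]/(w ^ j) exprzAC.
by move: Nk; rewrite -(omegaz_eq1 R N_gt0) => /eqP ->; rewrite exp1rz mulr1.
Qed.

(** For fixed L_0 the equation is linear in L. The substitution is a ring morphism fixing z and L_0,
    so it can be applied to the equation, which is then solved for the image of L. *)
Lemma qsubst_fraction (z := fpsX (laurent C)) (L L0 : fps (laurent C)) (u : C) :
  u != 0 -> qsubst u L0 = L0 ->
  L = 1 + z * (fpsC (lmono 1 1) + fpsC (lmono 1 (-1))) * L
        + 2 * z ^+ 2 * L * L0 - z ^+ 2 * L0 ^+ 2 ->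
  qsubst u L = (1 - z ^+ 2 * L0 ^+ 2) /
    (1 - z * (fpsC (lmono u 1) + fpsC (lmono u^-1 (-1))) - 2 * z ^+ 2 * L0).
Proof.
move=> u0 uL0 LE.
pose phi : {rmorphism _ -> _} := HB.pack (qsubst u)
  (GRing.isZmodMorphism.Build _ _ _ (qsubst_zmod_morphism u))
  (GRing.isMonoidMorphism.Build _ _ _ (qsubst_monoid_morphism u0)).
set D := 1 - _ - _.
have D_unit : D \is a GRing.unit.
  (* Every term of [D] other than 1 has a factor z, so its constant coefficient is 1. *)
  apply: fps_unit1; rewrite /D -mulrA -addrA -opprD exprS mulrCA -mulrA -mulrDr.
  rewrite -[LHS]/((1 : fps (laurent C)) 0%N - (z * _) 0%N).
  by rewrite fcoefXM subr0.
have phiz : phi z = z by exact: qsubstX.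
have phiL0 : phi L0 = L0 by [].
have phiq k : phi (fpsC (lmono 1 k)) = fpsC (lmono (u ^ k) k).
  by rewrite [LHS]qsubstC lsubst_mono mul1r.
rewrite -[LHS]/(phi L); apply: (canRL (mulrK D_unit)).
have -> : D = phi (1 - z * (fpsC (lmono 1 1) + fpsC (lmono 1 (-1)))
    - 2 * z ^+ 2 * L0).
  rewrite !rmorphB rmorph1 !rmorphM rmorphD rmorph_nat !phiq.
  by rewrite phiz phiL0 exprN1.
rewrite -rmorphM -[z in RHS]phiz -[L0 in RHS]phiL0 -[1 in RHS](rmorph1 phi).
rewrite -!rmorphXn -rmorphM -rmorphB; congr (phi _).
by rewrite mulrBr mulrBr {1}LE; ring.
Qed.

End Averaging.

Theorem proposition3p2 (R : realType) (N : nat) (hN : (1 <= N)%N) :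
  let C : fieldType := R[i] in
  let z : fps (laurent C) := fpsX (laurent C) in
  let q (c : C) (k : int) : fps (laurent C) := fpsC (lmono c k) in
  let w : C := omega R N in
  let G : fps (laurent C) := genfun C N (inH N) in
  let L : fps (laurent C) := genfun C N (inL N) in
  let K : fps (laurent C) := genfun C N (inK N) in
  let L0 : fps (laurent C) := Phi N%:Z N%:Z L in
  [/\ K = L,
      L = 1 + z * (q 1 1 + q 1 (-1)) * L + 2 * z ^+ 2 * L * L0
          - z ^+ 2 * L0 ^+ 2,
      G = 1 + z * (q 1 1 + q 1 (-1)) * G + 2 * z ^+ 2 * G * L0,
      N%:R * L0 = \sum_(j < N) qsubst (w ^+ j) L /\
      \sum_(j < N) qsubst (w ^+ j) L =
        \sum_(j < N) (1 - z ^+ 2 * L0 ^+ 2) /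
          (1 - z * (q (w ^+ j) 1 + q (w ^- j) (-1)) - 2 * z ^+ 2 * L0)
    & (* the last identity makes L0 algebraic over C[q, q^-1][z] *)
      exists P : {poly {poly laurent C}},
        P != 0 /\ (map_poly (@fps_of_poly (laurent C)) P).[L0] = 0 ].
Proof.
move=> C z q w G L K L0.
have LE : L = langfun C (good N (pred1 (true, 0))) by exact: genfunL.
have L0E : L0 = excfun C N true by rewrite /L0 LE Phi_langfun.
have L_eq : L = 1 + z * (q 1 1 + q 1 (-1)) * L + 2 * z ^+ 2 * L * L0
    - z ^+ 2 * L0 ^+ 2 by rewrite LE L0E; exact: langfunL_eq.
have sumE := sum_qsubst_omega hN L.
have fracE : \sum_(j < N) qsubst (w ^+ j) L =
    \sum_(j < N) (1 - z ^+ 2 * L0 ^+ 2) /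
      (1 - z * (q (w ^+ j) 1 + q (w ^- j) (-1)) - 2 * z ^+ 2 * L0).
  apply: eq_bigr => j _; apply: qsubst_fraction => //.
    by rewrite expf_neq0 ?omega_neq0.
  exact: qsubst_omega_Phi.
split=> //.
- by rewrite /K (genfunK C hN) LE (langfun_good_swap C N true).
- by rewrite /G (genfunH C hN) L0E; exact: langfunH_eq.
(* [a j] is the part of the j-th denominator free of L_0, as a polynomial in z; z^2 and 2 z^2 are
   the remaining coefficients of numerator and denominator. *)
- pose a (j : 'I_N) : {poly laurent C} :=
    1 - 'X * ((lmono (w ^+ j) 1)%:P + (lmono (w ^- j) (-1))%:P).
  apply: (@sum_fraction_algebraic _ N a ('X ^+ 2) (2%:R * 'X ^+ 2)).
  + apply/eqP => /(congr1 (fun f : laurent C => f 0)).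
    by rewrite lcoefMn lcoef0 => /eqP; rewrite pnatr_eq0 -leqn0 leqNgt hN.
  + by move=> j; rewrite /a coefB coef1 coefXM subr0.
  + by rewrite coefXn.
  + by rewrite mulr_natl coefMn coefXn mul0rn.
  rewrite sumE fracE; apply: eq_bigr => j _.
  rewrite /a !rmorphB rmorph1 !rmorphM rmorphD rmorph_nat /=.
  by rewrite !fps_of_polyX !fps_of_polyC.
Qed.
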